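(* For any graph $G$, $\textnormal{ftdim}(G)=2$ if and only if $G$ has order at least $2$, at most $2$ connected components, at most $1$ connected component of size at least $2$, and every connected component is a singleton or a path.
   Context: Graphs are finite, simple, undirected, possibly disconnected; $\textnormal{dist}(u,v)=\infty$ between different components. A set $S=\{v_1,\dots,v_k\}$ of vertices is a resolving set of $G$ if the vectors $(\textnormal{dist}(u,v_1),\dots,\textnormal{dist}(u,v_k))$ are pairwise distinct over $u\in V(G)$. $\textnormal{ftdim}(G)$ is the minimum size of a nonempty $S\subseteq V(G)$ such that $S-\{s\}$ is a resolving set for every $s\in S$. *)

(* Defs.v *)
(* MathComp *)
From mathcomp Require Import all_boot.

Set Implicit Arguments.
Unset Strict Implicit.
Unset Printing Implicit Defensive.

Record sgraph := SGraph {
  vertex :> finType;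
  adj : rel vertex;
  adj_sym : symmetric adj;
  adj_irr : irreflexive adj }.

Section Graph.
Variable G : sgraph.
Implicit Types (x y : G) (S C : {set G}).

Definition walk (n : nat) (x y : G) : bool :=
  [exists p : n.-tuple G, path (@adj G) x p && (last x p == y)].

Lemma connect_walk x y : connect (@adj G) x y -> exists n, walk n x y.
Proof.
case/connectP=> p e_p ->; exists (size p).
by apply/existsP; exists (in_tuple p); rewrite e_p eqxx.
Qed.

(* [None] stands for infinity. *)
Definition dist (x y : G) : option nat :=
  match @idP (connect (@adj G) x y) with
  | ReflectT xy => Some (ex_minn (connect_walk xy))
  | ReflectF _ => None
  end.

Definition resolving (S : {set G}) : Prop :=
  injective (fun u : G => [seq dist u v | v <- enum S]).

Definition resolvingb (S : {set G}) : bool :=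
  injectiveb (fun u : G => [seq dist u v | v <- enum S]).

Lemma resolvingP S : reflect (resolving S) (resolvingb S).
Proof. exact: injectiveP. Qed.

Definition ft_resolving (S : {set G}) : bool :=
  (S != set0) && [forall s in S, resolvingb (S :\ s)].

(* If G has no vertex then no set is [ft_resolving], and [ftdim] is 0 by
   convention; otherwise the default [setT] is [ft_resolving] (see
   [ft_resolvingT]), so this is the true minimum. *)
Definition ftdim : nat :=
  #|[arg min_(S < [set: G] | ft_resolving S) #|S|]|.

Lemma dist_eq0 x y : (dist x y == Some 0) = (x == y).
Proof.
rewrite /dist; case: {-}_ / idP => [xy|nxy]; last first.
  by apply/esym/negbTE/eqP=> exy; apply: nxy; rewrite exy connect0.
case: ex_minnP => n /existsP[p /andP[_ /eqP lp]] min_n.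
apply/eqP/eqP=> [[n0]|exy].
  by move: p lp; rewrite n0 => p; rewrite tuple0.
congr Some; apply/eqP; rewrite -leqn0; apply: min_n.
by apply/existsP; exists [tuple]; rewrite /= exy.
Qed.

Lemma ft_resolvingT (x0 : G) : ft_resolving [set: G].
Proof.
apply/andP; split; first by apply/set0Pn; exists x0; rewrite inE.
apply/forall_inP=> s _; apply/resolvingP=> u w /eq_in_map eq_uw.
have D v : v != s -> dist u v = dist w v.
  by move=> vs; apply: eq_uw; rewrite mem_enum !inE vs.
case: (eqVneq u s) => [us|us]; last first.
  by apply/esym/eqP; rewrite -dist_eq0 -(D u us) dist_eq0.
case: (eqVneq w s) => [->//|ws].
by apply/eqP; rewrite -dist_eq0 (D w ws) dist_eq0.
Qed.

Lemma ftdimP (x0 : G) :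
  (exists2 S, ft_resolving S & #|S| = ftdim) /\
  (forall S, ft_resolving S -> ftdim <= #|S|).
Proof.
rewrite /ftdim; case: arg_minnP; first exact: ft_resolvingT.
by move=> S ftS minS; split; first by exists S.
Qed.

Definition components : {set {set G}} :=
  equivalence_partition (connect (@adj G)) [set: G].

(* The subgraph induced on C is isomorphic to the path on n.+1 vertices. *)
Definition is_path (C : {set G}) : Prop :=
  exists (n : nat) (f : 'I_n.+1 -> G),
    [/\ injective f,
        C = [set f i | i : 'I_n.+1] &
        forall i j, adj (f i) (f j) = (i.+1 == j) || (j.+1 == i)].

End Graph.

(* Main.v *)
Require Import Defs.
From mathcomp Require Import all_boot.
From mathcomp Require Import zify.

(** [S = {a, b}] is fault-tolerant resolving iff [a] and [b] each resolve [G]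
    alone.  If [a] resolves [G], each distance from [a] is attained once:
    the component of [a] is a path enumerated by the distance from its end [a],
    and at most one vertex lies outside it, at infinite distance.  Conversely,
    both ends of the unique large component resolve [G]; when every component
    is a singleton, any two vertices do. *)

Set Implicit Arguments.
Unset Strict Implicit.
Unset Printing Implicit Defensive.

Section Resolving.
Variable G : sgraph.
Implicit Types (x y z a b : G) (S C D : {set G}).

Local Notation conn := (connect (@adj G)).

(** * Walks and distances *)

Lemma conn_sym : connect_sym (@adj G).
Proof. exact/sym_connect_sym/adj_sym. Qed.

Lemma walk0 x y : walk 0 x y = (x == y).
Proof.
apply/existsP/eqP => [[p]|->]; first by rewrite tuple0 /= => /eqP.
by exists [tuple] => /=.
Qed.

Lemma walkS n x y : walk n.+1 x y = [exists z, adj x z && walk n z y].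
Proof.
apply/existsP/existsP => [[p]|[z /andP[xz /existsP[p pP]]]].
  case/tupleP: p => z p /= /andP[/andP[xz pP] lP].
  by exists z; rewrite xz; apply/existsP; exists p; rewrite pP.
by exists [tuple of z :: p]; rewrite /= xz.
Qed.

Lemma walk_connect n x y : walk n x y -> conn x y.
Proof.
by case/existsP=> p /andP[pP /eqP lP]; apply/connectP; exists p.
Qed.

Lemma dist_SomeP x y n :
  dist x y = Some n <-> walk n x y /\ forall m, walk m x y -> n <= m.
Proof.
rewrite /dist; case: {-}_ / idP => [xy|nxy]; last first.
  by split=> // -[/walk_connect].
case: ex_minnP => k wk mink; split=> [[<-] // | [wn minn]].
by congr Some; apply/eqP; rewrite eqn_leq mink ?minn.
Qed.

Lemma dist_None x y : (dist x y == None) = ~~ conn x y.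
Proof. by rewrite /dist; case: {-}_ / idP => [xy|/negP->] //; rewrite xy. Qed.

Lemma dist_Some_connect x y n : dist x y = Some n -> conn x y.
Proof. by move=> d; apply: contraT; rewrite -dist_None d. Qed.

Lemma connect_dist x y : conn x y -> exists n, dist x y = Some n.
Proof.
by rewrite -[conn x y]negbK -dist_None; case: dist => // n _; exists n.
Qed.

(** [z] is the second vertex of a shortest walk from [x] to [a]; a walk from [z] shorter than [k]
    would extend to one from [x] shorter than [k.+1]. *)
Lemma dist_pred x a k :
  dist x a = Some k.+1 -> exists2 z, adj x z & dist z a = Some k.
Proof.
case/dist_SomeP; rewrite walkS => /existsP[z /andP[xz wz]] min_k.
exists z => //; apply/dist_SomeP; split=> // m wm.
by apply: (min_k m.+1); rewrite walkS; apply/existsP; exists z; rewrite xz.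
Qed.

Lemma dist_adj_leq x y a i j :
  adj x y -> dist x a = Some i -> dist y a = Some j -> j <= i.+1.
Proof.
move=> xy /dist_SomeP[wi _] /dist_SomeP[_]; apply.
by rewrite walkS; apply/existsP; exists x; rewrite adj_sym xy.
Qed.

(** * Components and single resolving vertices *)

Lemma resolving1P a : reflect (injective (@dist G ^~ a)) (resolvingb [set a]).
Proof.
apply: (iffP (resolvingP _)) => inj x y; rewrite ?enum_set1.
  by move=> xy; apply: inj; rewrite enum_set1 /= xy.
by case; apply: inj.
Qed.

Definition component x : {set G} := [set y | conn x y].

Lemma componentsP C :
  reflect (exists x, C = component x) (C \in components G).
Proof.
by apply: (iffP imsetP) => [[x _ ->]|[x ->]]; exists x => //; apply/setP=> y;
  rewrite !inE.
Qed.

Lemma component_components x : component x \in components G.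
Proof. by apply/componentsP; exists x. Qed.

Lemma component_eq x y : conn x y -> component x = component y.
Proof.
by move=> xy; apply/setP=> z; rewrite !inE (same_connect conn_sym xy).
Qed.

Lemma components_mem C x : C \in components G -> x \in C -> C = component x.
Proof. by case/componentsP=> y ->; rewrite inE => /component_eq. Qed.

(** Each distance layer around [a] holds at most one vertex, and every layer up to the eccentricity
    of [a] in its component is inhabited; the layers in order are the path. *)
Lemma resolving1_is_path a : injective (@dist G ^~ a) -> is_path (component a).
Proof.
(* The default 0 is never reached: [d] is evaluated only at vertices connected to [a]. *)
move=> inj; pose d x := odflt 0 (dist x a).
have [m ma max_m] := @arg_maxnP _ a (conn^~ a) d (connect0 _ _).
have dmax x : conn x a -> exists i : 'I_(d m).+1, dist x a = Some (val i).
  move=> xa; have [n dn] := connect_dist xa.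
  have lt_n : n < (d m).+1 by have := max_m x xa; rewrite /d dn ltnS.
  by exists (Ordinal lt_n).
have layer k : k <= d m -> exists x, dist x a == Some k.
  (* Descend from the farthest vertex [m], one layer closer to [a] each time; once layer 0 is
     reached, the truncated subtraction stays there. *)
  move=> le_k; rewrite -(subKn le_k); elim: (d m - k) => [|j [x /eqP dx]].
    by exists m; rewrite /d subn0; have [n ->] := connect_dist ma.
  have [le_mj|lt_jm] := leqP (d m) j.
    by exists x; rewrite dx; apply/eqP; congr Some; lia.
  have [|z _ dz] := @dist_pred x a (d m - j.+1).
    by rewrite dx; congr Some; rewrite subnSK.
  by exists z; rewrite dz.
have ex (i : 'I_(d m).+1) : exists x, dist x a == Some (val i).
  exact/layer/(leq_ord i).
pose f i := xchoose (ex i).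
have df i : dist (f i) a = Some (val i) by apply/eqP/(xchooseP (ex i)).
have fS (i j : 'I_(d m).+1) : i.+1 = j -> adj (f i) (f j).
  (* The neighbour [z] of [f j] one step closer to [a] lies in layer [i], whose only vertex is
     [f i]. *)
  move=> ij; have [|z fz dz] := @dist_pred (f j) a i; first by rewrite df /= -ij.
  by rewrite adj_sym (inj (f i) z) // df dz.
exists (d m), f; split=> [i j fij|| i j].
- by apply: val_inj; apply: Some_inj; rewrite -!df fij.
- apply/setP=> x; rewrite inE conn_sym; apply/idP/imsetP=> [xa|[i _ ->]].
    by have [i dx] := dmax x xa; exists i => //; apply: inj; rewrite df.
  exact: dist_Some_connect (df i).
apply/idP/orP=> [fij|[/eqP/fS //|/eqP/fS]]; last by rewrite adj_sym.
apply/orP.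
(* Adjacent vertices lie in layers differing by at most one, and not in the same layer, since that
   would make a loop. *)
have le_ji := dist_adj_leq fij (df i) (df j).
have le_ij : val i <= (val j).+1.
  by apply: dist_adj_leq (df j) (df i); rewrite adj_sym.
have neq_ij : val i != val j.
  by apply: contraTneq fij => /val_inj->; rewrite adj_irr.
by move: le_ji le_ij neq_ij => /=; lia.
Qed.

(** Inside [C] the distance to the end [f ord0] is the index along the path; the at most one vertex
    outside [C] is alone at infinite distance. *)
Lemma path_end_resolving n (f : 'I_n.+1 -> G) C :
    injective f -> C = [set f i | i : 'I_n.+1] ->
    (forall i j, adj (f i) (f j) = (i.+1 == j) || (j.+1 == i)) ->
    C \in components G -> {in ~: C &, forall x y, x = y} ->
  injective (@dist G ^~ (f ord0)).
Proof.
move=> inj_f defC adj_f compC outC.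
have fC i : f i \in C by rewrite defC imset_f.
have defC0 := components_mem compC (fC ord0).
(* A walk ending in [C] never leaves this component, and each of its edges changes the index by
   exactly one. *)
have dle m : forall i, walk m (f i) (f ord0) -> i <= m.
  elim: m => [|m IHm] i; first by rewrite walk0 => /eqP/inj_f->.
  rewrite walkS => /existsP[z /andP[iz wz]].
  have: z \in C by rewrite defC0 inE conn_sym (walk_connect wz).
  rewrite defC => /imsetP[j _ def_z]; move: iz wz; rewrite {z}def_z adj_f.
  move=> ij /IHm; case/orP: ij => /eqP; last by move=> <-.
  by move=> <- lt_im; rewrite ltnW // ltnW.
have wf m : forall i : 'I_n.+1, val i = m -> walk m (f i) (f ord0).
  elim: m => [|m IHm] i im.
    by rewrite walk0; apply/eqP; congr f; apply: val_inj.
  have lt_m : m < n.+1 by rewrite ltnW // -im ltn_ord.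
  rewrite walkS; apply/existsP; exists (f (Ordinal lt_m)).
  by rewrite adj_f im eqxx orbT IHm.
have df i : dist (f i) (f ord0) = Some (val i).
  by apply/dist_SomeP; split=> [|m]; [apply: wf | apply: dle].
have C0 x : (x \in C) = (dist x (f ord0) != None).
  by rewrite dist_None negbK defC0 inE conn_sym.
move=> x y /= dxy; have [Cx|C'x] := boolP (x \in C); last first.
  by apply: outC; rewrite inE // C0 -dxy -C0.
have Cy: y \in C by rewrite C0 -dxy -C0.
move: Cx Cy dxy; rewrite defC => /imsetP[i _ ->] /imsetP[j _ ->].
by rewrite !df => -[/val_inj->].
Qed.

(** * Reduction to two individually resolving vertices *)

Lemma ft_resolving_card S : 2 <= #|G| -> ft_resolving S -> 2 <= #|S|.
Proof.
move=> G2 /andP[]; rewrite -card_gt0 => S0 /forall_inP resS.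
rewrite ltn_neqAle S0 andbT; apply: contraL G2 => /eqP/esym/eqP/cards1P[s defS].
have /resolvingP inj := resS s ltac:(by rewrite defS set11).
(* Removing [s] leaves the empty set, for which all distance vectors are empty and hence equal. *)
rewrite -leqNgt; apply/fintype_le1P => x y; apply: inj.
by rewrite defS setDv enum_set0.
Qed.

Lemma ftdim2P :
  ftdim G = 2 <->
  exists a b, [/\ a != b, injective (@dist G ^~ a) & injective (@dist G ^~ b)].
Proof.
have D1 a b : a != b -> [set a; b] :\ a = [set b].
  by move=> ab; rewrite setU1K // inE.
split=> [dim2|[a [b [ab inj_a inj_b]]]].
  (* [ftdimP] needs a vertex; in the empty graph the conventional value of [ftdim] cannot be 2,
     being the size of a set of vertices. *)
  have [x0 _|G0] := pickP (@predT G); last first.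
    by have := max_card [arg min_(S < [set: G] | ft_resolving S) #|S|];
      rewrite -/(ftdim G) dim2 (eq_card0 G0).
  have [[S /andP[_ /forall_inP resS] cardS] _] := ftdimP x0.
  move: cardS; rewrite dim2 => /eqP/cards2P[a [b [ab defS]]].
  exists a, b; split=> //; apply/resolving1P.
    rewrite -(D1 b a) 1?eq_sym // setUC -defS.
    by apply: resS; rewrite defS set22.
  by rewrite -(D1 a b) // -defS; apply: resS; rewrite defS set21.
have [[S ftS cardS] min_dim] := ftdimP a.
have G2 : 2 <= #|G|.
  by rewrite -[2](_ : #|[set a; b]| = _) ?max_card // cards2 ab.
apply/eqP; rewrite eqn_leq -{2}cardS ft_resolving_card // andbT.
rewrite -[2](_ : #|[set a; b]| = _); last by rewrite cards2 ab.
apply: min_dim; apply/andP; split; first by apply/set0Pn; exists a; rewrite set21.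
apply/forall_inP=> s /set2P[]->; first by rewrite D1 //; apply/resolving1P.
by rewrite setUC D1 1?eq_sym //; apply/resolving1P.
Qed.

(** Only one component other than [C] can remain, and it has at most one vertex. *)
Lemma outside_component_eq C :
    #|components G| <= 2 -> C \in components G ->
    (forall D, D \in components G -> D != C -> #|D| <= 1) ->
  {in ~: C &, forall x y, x = y}.
Proof.
move=> comp2 compC small x y; rewrite !inE => C'x C'y.
have neqC z : z \notin C -> component z != C.
  by apply: contraNneq => <-; rewrite inE connect0.
have comp1 : #|components G :\ C| <= 1.
  by move: comp2; rewrite (cardsD1 C) compC.
have eq_xy : component x = component y.
  by apply: (card_le1_eqP comp1);
    rewrite in_setD1 component_components neqC.
apply: (card_le1_eqP (small _ (component_components x) (neqC _ C'x))).
  by rewrite eq_xy inE connect0.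
by rewrite inE connect0.
Qed.

End Resolving.

Theorem theorem3 (G : sgraph) :
  ftdim G = 2 <->
  [/\ 2 <= #|G|,
      #|components G| <= 2,
      #|[set C in components G | 2 <= #|C|]| <= 1 &
      forall C : {set G}, C \in components G -> #|C| = 1 \/ is_path C].
Proof.
split=> [/ftdim2P[a [b [ab inj_a _]]]|[G2 comp2 big1 pathC]]; last first.
  apply/ftdim2P.
  (* If a large component exists, it is a path and its two ends serve as [a] and [b]; otherwise any
     two distinct vertices do. *)
  have [C /andP[compC C2]|small] := pickP [pred C in components G | 2 <= #|C|].
    have outC : {in ~: C &, forall x y : G, x = y}.
      apply: outside_component_eq => // D compD.
      apply: contraR; rewrite -ltnNge => D2.
      by apply/eqP/(card_le1_eqP big1); rewrite inE ?compD ?compC.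
    have [C1|[n [f [inj_f defC adj_f]]]] := pathC C compC.
      by rewrite C1 in C2.
    have n_gt0 : 0 < n.
      by move: C2; rewrite defC card_imset // card_ord.
    exists (f ord0), (f ord_max); split.
    - by rewrite (inj_eq inj_f) -val_eqE /= eq_sym -lt0n.
    - exact: path_end_resolving inj_f defC adj_f compC outC.
    (* The other end is the initial vertex of the same path traversed backwards. *)
    have <- : rev_ord ord0 = ord_max :> 'I_n.+1.
      by apply: val_inj; rewrite /= subn1.
    apply: (@path_end_resolving _ n (f \o @rev_ord _) C) => //.
    - exact: inj_comp inj_f rev_ord_inj.
    - rewrite defC; apply/setP=> x; apply/imsetP/imsetP=> -[i _ ->].
        by exists (rev_ord i); rewrite //= rev_ordK.
      by exists (rev_ord i).
    move=> i j; rewrite /= adj_f /= !subSS orbC.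
    (* These bounds keep [n - i] and [n - j] from truncating, so that reversal exchanges the two
       adjacency cases. *)
    have := ltn_ord i; have := ltn_ord j; rewrite !ltnS => jn in_.
    lia.
  have small1 (D : {set G}) : D \in components G -> #|D| <= 1.
    by move=> compD; have := small D; rewrite /= compD /= ltnNge => /negbFE.
  have single x y : connect (@adj G) x y -> x = y.
    move=> xy; apply: (card_le1_eqP (small1 _ (component_components x)));
      by rewrite inE ?xy ?connect0.
  (* A vertex at finite distance from [a] is [a] itself, and at most one vertex lies outside the
     singleton component of [a]. *)
  have inj a : injective (@dist G ^~ a).
    move=> x y /= dxy; case dx: (dist x a) => [n|].
      rewrite (single _ _ (dist_Some_connect dx)).
      by rewrite dxy in dx; rewrite (single _ _ (dist_Some_connect dx)).
    apply: (@outside_component_eq _ (component a)) => //.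
    - exact: component_components.
    - by move=> D /small1.
    - by rewrite !inE conn_sym -dist_None dx.
    by rewrite !inE conn_sym -dist_None -dxy dx.
  have /card_gt1P[a [b [_ _ ab]]] := G2; by exists a, b.
(* Infinity, too, is attained at most once as a distance to [a]. Hence any component other than that
   of [a] is one and the same singleton. *)
have out x y : ~~ connect (@adj G) x a -> ~~ connect (@adj G) y a -> x = y.
  by rewrite -!dist_None => /eqP dx /eqP dy; apply: inj_a; rewrite dx.
have compE C : C \in components G -> C != component a ->
    exists2 x, C = component x & ~~ connect (@adj G) x a.
  case/componentsP=> x -> neq; exists x => //.
  by apply: contraNN neq => /component_eq->.
have comp1 C : C \in components G -> C != component a -> #|C| = 1.
  move=> compC neq; have [x -> xa] := compE C compC neq.
  apply/eqP/cards1P; exists x; apply/setP=> y; rewrite !inE.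
  apply/idP/eqP=> [xy|->]; last exact: connect0.
  by apply: out => //; rewrite -(same_connect (@conn_sym G) xy).
split.
- by rewrite -[2](_ : #|[set a; b]| = _) ?max_card // cards2 ab.
- rewrite (cardsD1 (component a)) component_components.
  apply/card_le1_eqP=> C D; rewrite !in_setD1.
  move=> /andP[nC cC] /andP[nD cD].
  have [x -> xa] := compE C cC nC; have [y -> ya] := compE D cD nD.
  by rewrite (out x y).
- suff big C : C \in components G -> 2 <= #|C| -> C = component a.
    apply/card_le1_eqP=> C D; rewrite !inE => /andP[cC C2] /andP[cD D2].
    by rewrite (big C) // (big D).
  by move=> cC; apply: contraTeq => /(comp1 C cC)->.
move=> C compC; have [->|neq] := eqVneq C (component a).
  by right; apply: resolving1_is_path.
by left; apply: comp1.
Qed.
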